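(* Under Assumptions 1–2, assume $k_\ell<m_\ell n_\ell$ for all $\ell$. (i) If $0<\beta_1\le1$, $\tau\ge\frac{64}{3\beta_1\underline\delta}$ and $0<\eta\le\min\Big\{\frac1{4L},\sqrt{\frac{3\underline\delta\beta_1^2}{80L^2}},\sqrt{\frac{3\underline\delta}{80\tau^2L^2}},\sqrt{\frac{3\beta_1}{16\tau L^2}}\Big\}$, then deterministic GaSare with MSGD satisfies $\frac1{K\tau}\sum_{t=0}^{K\tau-1}\|\nabla f(x^{(t)})\|_2^2\le\frac{16\Delta}{\underline\delta\eta K\tau}$ for every integer $K\ge1$. (ii) If moreover $\Delta>0$, $T\ge64/(3\underline\delta)$ is an integer and one chooses $\beta_1=1$, $\tau=\lceil64/(3\underline\delta\beta_1)\rceil$, $\eta=\Big(4L+\sqrt{\tfrac{80L^2}{3\underline\delta\beta_1^2}}+\sqrt{\tfrac{80\tau^2L^2}{3\underline\delta}}+\sqrt{\tfrac{16\tau L^2}{3\beta_1}}\Big)^{-1}$, then $\frac1T\sum_{t=0}^{T-1}\|\nabla f(x^{(t)})\|_2^2\le C\frac{L\Delta}{\underline\delta^{5/2}T}$ for an absolute constant $C$.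
   Context: Parameters $x=(\mathrm{vec}(X_1)^\top,\dots,\mathrm{vec}(X_{N_L})^\top)^\top\in\mathbb{R}^d$, $X_\ell\in\mathbb{R}^{m_\ell\times n_\ell}$; $\nabla_\ell$ is the gradient w.r.t. $X_\ell$. Assumption 1: $\inf f>-\infty$. Assumption 2: $\nabla f$ is $L$-Lipschitz in $\|\cdot\|_2$. $\Delta=f(x^{(0)})-\inf f$, $\delta_\ell=k_\ell/(m_\ell n_\ell)$, $\underline\delta=\min_\ell\delta_\ell$. Deterministic GaSare with MSGD: $M_\ell^{(-1)}=0$. For $t\ge0$, $G_\ell^{(t)}=\nabla_\ell f(x^{(t)})$; if $t\equiv0\pmod\tau$, $S_\ell^{(t)}$ is a Top-$k_\ell$ mask of $G_\ell^{(t)}$ (the $0/1$ matrix with exactly $k_\ell$ ones at positions of $k_\ell$ entries of largest absolute value, ties arbitrary), else $S_\ell^{(t)}=S_\ell^{(t-1)}$; $M_\ell^{(t)}=(1-\beta_1)S_\ell^{(t)}\odot M_\ell^{(t-1)}+\beta_1S_\ell^{(t)}\odot G_\ell^{(t)}$; $X_\ell^{(t+1)}=X_\ell^{(t)}-\eta S_\ell^{(t)}\odot M_\ell^{(t)}$ ($\odot$ = entrywise product). *)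

(* Defs.v *)
From HB Require Import structures.
From mathcomp Require Import all_boot all_order all_algebra.
From mathcomp Require Import all_classical all_reals all_analysis.
Set Implicit Arguments. Unset Strict Implicit. Unset Printing Implicit Defensive.
Import Order.TTheory GRing.Theory Num.Theory.
Local Open Scope ring_scope.

(* Coordinates of the parameter vector x = (vec X_1, ..., vec X_{N_L}):
   a coordinate is a layer index l together with an entry (i, j) of X_l. *)
Definition coord (NL : nat) (m n : 'I_NL -> nat) : finType :=
  {l : 'I_NL & ('I_(m l) * 'I_(n l))%type}.

Definition pvec (R : realType) NL (m n : 'I_NL -> nat) := {ffun coord m n -> R}.

Definition sqnorm (R : realType) NL (m n : 'I_NL -> nat) (v : pvec R m n) : R :=
  \sum_p v p ^+ 2.
Definition norm2 (R : realType) NL (m n : 'I_NL -> nat) (v : pvec R m n) : R :=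
  Num.sqrt (sqnorm v).
Definition inner (R : realType) NL (m n : 'I_NL -> nat) (u v : pvec R m n) : R :=
  \sum_p u p * v p.

Definition hprod (R : realType) NL (m n : 'I_NL -> nat) (u v : pvec R m n)
  : pvec R m n := [ffun p => u p * v p].

Definition is_gradient (R : realType) NL (m n : 'I_NL -> nat)
  (f : pvec R m n -> R) (g : pvec R m n -> pvec R m n) : Prop :=
  forall x v : pvec R m n,
    is_derive (0 : R) (1 : R) (fun s : R => f (x + s *: v)) (inner (g x) v).

Definition lipschitz_grad (R : realType) NL (m n : 'I_NL -> nat)
  (g : pvec R m n -> pvec R m n) (L : R) : Prop :=
  forall x y, norm2 (g x - g y) <= L * norm2 (x - y).

Definition is_topk_mask (R : realType) NL (m n k : 'I_NL -> nat)
  (G S : pvec R m n) : Prop :=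
  (forall p, S p = 0 \/ S p = 1) /\
  (forall l : 'I_NL, #|[set p : coord m n | (tag p == l) && (S p == 1)]| = k l) /\
  (forall p q : coord m n, tag p = tag q -> S p = 1 -> S q = 0 ->
     `|G q| <= `|G p|).

(* Deterministic GaSare with MSGD, starting from X 0, with M^{(-1)} = 0. *)
Definition gasare_msgd (R : realType) NL (m n k : 'I_NL -> nat)
  (g : pvec R m n -> pvec R m n) (beta1 eta : R) (tau : nat)
  (X M S : nat -> pvec R m n) : Prop :=
  forall t : nat,
    (if (t %% tau == 0)%N then is_topk_mask k (g (X t)) (S t)
     else S t = S t.-1) /\
    M t = (1 - beta1) *: hprod (S t) (if t is t'.+1 then M t' else 0)
          + beta1 *: hprod (S t) (g (X t)) /\
    X t.+1 = X t - eta *: hprod (S t) (M t).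

(* delta_l = k_l / (m_l n_l), and its minimum over layers (N_L >= 1 is
   assumed in the theorem; since delta_l < 1 the neutral element 1 is harmless) *)
Definition delta_l NL (m n k : 'I_NL -> nat) (R : realType) (l : 'I_NL) : R :=
  (k l)%:R / ((m l)%:R * (n l)%:R).
Definition delta_min NL (m n k : 'I_NL -> nat) (R : realType) : R :=
  \big[Order.min/1]_(l < NL) delta_l m n k R l.

Definition Delta (R : realType) NL (m n : 'I_NL -> nat) (f : pvec R m n -> R)
  (x0 : pvec R m n) : R := f x0 - inf (range f).

(* Main.v *)
Require Import Defs.
From HB Require Import structures.
From mathcomp Require Import all_boot all_order all_algebra.
From mathcomp Require Import all_classical all_reals all_analysis.
From mathcomp Require Import ring lra.
Import Order.TTheory GRing.Theory Num.Theory.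
Local Open Scope ring_scope.

(** Write [e_t = M_t - S_t g_t] for the momentum error; [M_t] is supported on
    the mask, so the descent lemma gives
    [f_{t+1} <= f_t - eta/2 |S_t g_t|^2 - 3 eta/8 |M_t|^2 + eta/2 |e_t|^2].
    Top-k selection keeps a fraction [delta] of the squared norm of the gradient
    at the start of a block of [tau] steps, hence, up to the drift of the gradient
    inside the block, a fixed fraction of [delta |g_t|^2] at each of its steps.
    The error contracts by [1 - b] at each step, except that a change of mask may
    add [|g_t|^2]; this happens once per block, so after division by [b] these
    terms are paid for by [tau >= 64 / (3 b delta)].  All drifts are bounded by
    [|M_t|^2] and absorbed for small [eta]. *)

(** * Quadratic inequalities for parameter vectors and the descent lemma *)

Section Vectors.
Context {R : realType} {NL : nat} {m n : 'I_NL -> nat}.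
Implicit Types u v w x y S M : pvec R m n.

Lemma sqnorm_ge0 u : 0 <= sqnorm u.
Proof. by apply: sumr_ge0 => p _; exact: sqr_ge0. Qed.

Lemma sqnormZ (a : R) u : sqnorm (a *: u) = a ^+ 2 * sqnorm u.
Proof. by rewrite mulr_sumr; apply: eq_bigr => p _; rewrite ffunE exprMn. Qed.

Lemma sqnormN u : sqnorm (- u) = sqnorm u.
Proof. by apply: eq_bigr => p _; rewrite ffunE sqrrN. Qed.

Lemma sqnormD_le2 u v : sqnorm (u + v) <= 2 * sqnorm u + 2 * sqnorm v.
Proof.
rewrite !mulr_sumr -big_split/=; apply: ler_sum => p _; rewrite ffunE.
have := sqr_ge0 (u p - v p); nra.
Qed.

Lemma sqnormB_le2 u v : sqnorm u <= 2 * sqnorm v + 2 * sqnorm (u - v).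
Proof. by have := sqnormD_le2 v (u - v); rewrite addrC subrK. Qed.

(** Young's inequality cleared of denominators: in each coordinate the two sides differ by exactly
    [(u p - a * v p) ^+ 2]. *)
Lemma sqnormD_weighted (a : R) u v : 0 <= a ->
  a * sqnorm (u + v) <= (a + 1) * sqnorm u + a * (a + 1) * sqnorm v.
Proof.
move=> a0; rewrite !mulr_sumr -big_split/=; apply: ler_sum => p _.
by rewrite ffunE; have := sqr_ge0 (u p - a * v p); nra.
Qed.

Lemma sqnorm_sum_le (F : nat -> pvec R m n) (j : nat) :
  sqnorm (\sum_(i < j) F i) <= j%:R * \sum_(i < j) sqnorm (F i).
Proof.
elim: j => [|j IHj].
  by rewrite !big_ord0 mulr0 /sqnorm big1// => p _; rewrite ffunE expr0n.
rewrite !big_ord_recr/=; have := IHj; case: j {IHj} => [|j] IHj.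
  by rewrite !big_ord0 !add0r mul1r.
have j0 : (0 : R) < j.+1%:R by rewrite ltr0n.
(* The weight is the number [j.+1] of terms already summed; this makes the factor grow from [j.+1]
   to [j.+2] with no loss. *)
rewrite -(ler_pM2l j0); apply: (le_trans (sqnormD_weighted _ _ _ (ltW j0))).
rewrite -[in X in _ <= X]natr1; have := ler_wpM2l (ltW (addr_gt0 j0 ltr01)) IHj.
by move: (\sum_(i < _) _) => s; nra.
Qed.

Lemma innerBl u v w : inner (u - v) w = inner u w - inner v w.
Proof.
rewrite /inner -sumrB; apply: eq_bigr => p _.
by rewrite !ffunE mulrBl.
Qed.

(** Cauchy-Schwarz for vectors with |u| <= a |v|, in a form free of square roots: it follows from 2a
    uv <= u^2 + a^2 v^2 in each coordinate. *)
Lemma inner_le (a : R) u v : 0 < a -> sqnorm u <= a ^+ 2 * sqnorm v ->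
  inner u v <= a * sqnorm v.
Proof.
move=> a0 uv; have a20 : 0 < 2 * a by lra.
suff h : 2 * a * inner u v <= sqnorm u + a ^+ 2 * sqnorm v.
  by rewrite -(ler_pM2l a20); nra.
rewrite !mulr_sumr -big_split/=; apply: ler_sum => p _.
by have := sqr_ge0 (u p - a * v p); nra.
Qed.

Lemma lipschitz_sqnorm (g : pvec R m n -> pvec R m n) (L : R) :
  lipschitz_grad g L ->
  forall x y, sqnorm (g x - g y) <= L ^+ 2 * sqnorm (x - y).
Proof.
move=> gL x y; rewrite -(sqr_sqrtr (sqnorm_ge0 (g x - g y))).
rewrite -(sqr_sqrtr (sqnorm_ge0 (x - y))) -exprMn.
by rewrite lerXn2r// ?nnegrE ?sqrtr_ge0// (le_trans _ (gL x y))// sqrtr_ge0.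
Qed.

(** [is_gradient] speaks of the parameter value 0 only; moving the base point along the line reaches
    every [s]. *)
Lemma gradient_line (f : pvec R m n -> R) (g : pvec R m n -> pvec R m n) x v s :
  is_gradient f g ->
  is_derive (s : R) (1 : R) (fun r : R => f (x + r *: v)) (inner (g (x + s *: v)) v).
Proof.
move=> fg.
have -> : (fun r : R => f (x + r *: v)) =
          (fun r : R => f (x + s *: v + r *: v)) \o (shift (- s)).
  by apply/funext => r /=; rewrite -addrA -scalerDl [s + _]addrC subrK.
rewrite -[inner _ _]mulr1.
have hs : shift (- s) s = 0 by exact: subrr.
by apply: is_derive1_comp; [rewrite hs; exact: fg | exact: is_derive_shift].
Qed.

(** No integral is taken: [h] is [f] along the segment minus the quadratic model, its derivative is
    nonpositive on the open unit interval, and the mean value theorem compares [h 1] with [h 0]. *)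
Lemma descent_lemma (f : pvec R m n -> R) (g : pvec R m n -> pvec R m n) (L : R) :
  is_gradient f g -> 0 < L -> lipschitz_grad g L ->
  forall x v, f (x + v) <= f x + inner (g x) v + L / 2 * sqnorm v.
Proof.
move=> fg L0 gL x v.
pose q (s : R) : R := s * inner (g x) v + s ^+ 2 * (L / 2 * sqnorm v).
pose h : R -> R := (fun r => f (x + r *: v)) - q.
pose dh (s : R) := inner (g (x + s *: v)) v - (inner (g x) v + L * s * sqnorm v).
have dq (s : R) : is_derive s 1 q (inner (g x) v + L * s * sqnorm v).
  rewrite /q; apply: is_derive_eq.
  by rewrite /GRing.scale/=; field.
have dhE (s : R) : is_derive s 1 h (dh s).
  by have := gradient_line _ _ x v s fg => ?; exact: is_deriveB.
have [|c] := @MVT R h dh 0 1 ltr01 (fun s _ => dhE s).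
  by apply: derivable_within_continuous => s _; case: (dhE s).
rewrite in_itv/= => /andP[c0 c1] hc.
have dc : dh c <= 0.
  (* Here [inner_le] is used with [a := L * c], the Lipschitz bound at distance [c] times the norm
     of [v]. *)
  rewrite /dh opprD addrA -innerBl subr_le0; apply: inner_le; first exact: mulr_gt0.
  apply: (le_trans (lipschitz_sqnorm _ _ gL _ _)).
  by rewrite addrC addrA addNr add0r sqnormZ exprMn mulrA.
move: hc; rewrite subr0 mulr1 /h /q !fctE scale1r scale0r addr0 mul0r expr0n mul0r mul1r expr1n mul1r.
lra.
Qed.

End Vectors.

(** * Energy retained by a Top-k mask *)

(** The average over the largest values dominates the overall average. After the common part is
    cancelled, both sides become sums over pairs in [A] times [P :\: A], compared term by term. *)
Lemma top_average (R : realDomainType) (T : finType) (A P : {set T}) (F : T -> R) :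
  A \subset P -> (forall p q, p \in A -> q \in P :\: A -> F q <= F p) ->
  #|A|%:R * \sum_(q in P) F q <= #|P|%:R * \sum_(p in A) F p.
Proof.
move=> AP FAP; have cP := cardsID A P; rewrite (finset.setIidPr AP) in cP.
rewrite -cP (big_setID A)/= (finset.setIidPr AP) natrD mulrDl mulrDr lerD2l.
rewrite mulr_natl -sumr_const mulr_sumr; apply: ler_sum => p pA.
by rewrite mulr_natl -sumr_const; apply: ler_sum => q qP; exact: FAP.
Qed.

Section TopK.
Context {R : realType} {NL : nat} {m n : 'I_NL -> nat} (k : 'I_NL -> nat).
Hypothesis k_bounds : forall l, (0 < k l < m l * n l)%N.

Lemma card_layer (l : 'I_NL) : #|[set p : Defs.coord m n | tag p == l]| = (m l * n l)%N.
Proof.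
have -> : [set p : Defs.coord m n | tag p == l] =
          (@Tagged _ l (fun l => ('I_(m l) * 'I_(n l))%type)) @: [set: 'I_(m l) * 'I_(n l)].
  apply/finset.setP => p; rewrite inE; apply/eqP/imsetP => [<-|[ij _ ->]] //.
  by exists (tagged p) => //; case: p.
rewrite card_imset; first by rewrite cardsT card_prod !card_ord.
by move=> a b /eqP; rewrite eq_Tagged/= => /eqP.
Qed.

Lemma delta_min_gt0 : 0 < delta_min m n k R.
Proof.
apply: lt_bigmin => // l _; have /andP[k0 kmn] := k_bounds l.
have : (0 < m l * n l)%N by exact: ltn_trans kmn.
by rewrite muln_gt0 => /andP[m0 n0]; rewrite divr_gt0 ?mulr_gt0 ?ltr0n.
Qed.

Lemma delta_min_le1 : delta_min m n k R <= 1.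
Proof. exact: bigmin_le_id. Qed.

(** Layer by layer, [top_average] is applied to the squared entries, with the selected positions
    inside the whole layer; this gives the fraction [delta_l], which is at least [delta_min]. *)
Lemma topk_sqnorm (G S : pvec R m n) : is_topk_mask k G S ->
  delta_min m n k R * sqnorm G <= sqnorm (hprod S G).
Proof.
move=> [S01 [Sk Stop]]; rewrite /sqnorm.
rewrite (partition_big (@tag _ _) xpredT)//= [leRHS](partition_big (@tag _ _) xpredT)//=.
rewrite mulr_sumr; apply: ler_sum => l _.
have /andP[k0 kmn] := k_bounds l.
have mn0 : (0 : R) < (m l)%:R * (n l)%:R.
  by rewrite -natrM ltr0n; exact: ltn_trans kmn.
apply: (@le_trans _ _ (delta_l m n k R l * \sum_(p : Defs.coord m n | tag p == l) G p ^+ 2)).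
  by rewrite ler_wpM2r ?sumr_ge0// => [p _|]; [exact: sqr_ge0|exact: bigmin_le].
rewrite /delta_l mulrAC ler_pdivrMr//.
have -> : \sum_(p : Defs.coord m n | tag p == l) hprod S G p ^+ 2 =
          \sum_(p in [set p : Defs.coord m n | (tag p == l) && (S p == 1)]) G p ^+ 2.
  rewrite [RHS](eq_bigl (fun p : Defs.coord m n => (tag p == l) && (S p == 1))) => [|p]; last by rewrite inE.
  rewrite big_mkcondr; apply: eq_bigr => p _; rewrite ffunE.
  by case: (S01 p) => ->; rewrite ?mul0r ?mul1r ?eqxx// [0 == 1]eq_sym oner_eq0 expr0n.
rewrite -natrM -card_layer -(Sk l).
rewrite (_ : \sum_(p | _) _ = \sum_(p in [set p : Defs.coord m n | tag p == l]) G p ^+ 2);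
  last by apply: eq_bigl => p; rewrite inE.
rewrite [leRHS]mulrC; apply: top_average => [|p q].
  by apply/fintype.subsetP => p; rewrite !inE => /andP[].
rewrite !inE => /andP[/eqP pl /eqP Sp] /andP[+ /eqP ql].
rewrite ql eqxx/= => Sq; rewrite -(real_normK (num_real (G q))) -(real_normK (num_real (G p))).
rewrite lerXn2r ?nnegrE//; apply: Stop; rewrite ?pl ?ql//.
by case: (S01 q) => // h; rewrite h eqxx in Sq.
Qed.

End TopK.

(** * Sums over blocks and the scalar error recursion *)

Lemma sum_blocks (V : nmodType) (F : nat -> V) (K tau : nat) :
  \sum_(t < K * tau) F t = \sum_(r < K) \sum_(j < tau) F (r * tau + j)%N.
Proof.
elim: K => [|K IHK]; first by rewrite mul0n !big_ord0.
by rewrite mulSnr big_split_ord/= IHK big_ord_recr.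
Qed.

Lemma ler_sum_prefix (R : numDomainType) (F : nat -> R) (j N : nat) :
  (forall i, 0 <= F i) -> (j <= N)%N -> \sum_(i < j) F i <= \sum_(i < N) F i.
Proof.
move=> F0 /subnKC <-; rewrite big_split_ord/= lerDl.
by apply: sumr_ge0 => i _; exact: F0.
Qed.

(* The part of [x - s y'] outside the old mask is orthogonal to the old error, so a
   fresh mask costs [y' ^+ 2] itself and not [b^-1 * y' ^+ 2]; the latter would
   require [tau] of order [b^-2]. *)
Lemma momentum_error_coord (R : realFieldType) (b s s' x y y' : R) (fresh : bool) :
  0 < b -> b <= 1 -> s = 0 \/ s = 1 -> s' = 0 \/ s' = 1 -> s * x = x ->
  fresh \/ s' = s ->
  ((1 - b) * (s' * x) + b * (s' * y') - s' * y') ^+ 2 <=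
  (1 - b) * (x - s * y) ^+ 2 + b^-1 * (y' - y) ^+ 2 + fresh%:R * y' ^+ 2.
Proof.
move=> b0 b1 s01 s'01 sx fr.
have b1' : 0 <= 1 - b by rewrite subr_ge0.
have h1 : 0 <= (1 - b) * (x - s * y) ^+ 2 by rewrite mulr_ge0// sqr_ge0.
have h2 : 0 <= b^-1 * (y' - y) ^+ 2 by rewrite mulr_ge0 ?sqr_ge0// invr_ge0 ltW.
have h3 : 0 <= fresh%:R * y' ^+ 2 by rewrite mulr_ge0 ?sqr_ge0.
case: s'01 fr => -> fr; first by rewrite !mul0r !mulr0 addr0 subr0 expr0n/= !addr_ge0.
rewrite !mul1r; case: s01 sx fr h1 => -> sx fr h1.
  (* A newly opened coordinate carries no old momentum, so its error is [(b - 1) * y'], covered by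
     the fresh term. *)
  have x0 : x = 0 by rewrite -sx mul0r.
  have -> : fresh by case: fr => // /eqP; rewrite oner_eq0.
  rewrite mul1r; apply: ler_wpDl; first exact: addr_ge0.
  rewrite x0; have := sqr_ge0 y'; nra.
apply: ler_wpDr => //; rewrite -(ler_pM2l b0) mulrDr mulrA (mulrA b b^-1) divff ?gt_eqF// !mul1r.
pose a := x - y; pose h := y' - y.
have -> : (1 - b) * x + b * y' - y' = (1 - b) * (a - h) by rewrite /a /h; ring.
(* This sum of squares is exactly the difference of the two sides after multiplication by [b]. *)
have : 0 <= (1 - b) * (b * a + (1 - b) * h) ^+ 2 + (1 - (1 - b) ^+ 2) * h ^+ 2.
  by rewrite addr_ge0// mulr_ge0 ?sqr_ge0//; nra.
rewrite -/a -/h; lra.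
Qed.

(** * Error, drift and descent along a run *)

Section Gasare.
Context {R : realType} {NL : nat} {m n k : 'I_NL -> nat}.
Context {f : pvec R m n -> R} {g : pvec R m n -> pvec R m n}.
Context {L b eta : R} {tau : nat} {X M S : nat -> pvec R m n}.
Local Notation delta := (delta_min m n k R).
Hypothesis k_bounds : forall l, (0 < k l < m l * n l)%N.
Hypothesis fg : is_gradient f g.
Hypothesis f_lb : has_lbound (range f).
Hypothesis L_gt0 : 0 < L.
Hypothesis gL : lipschitz_grad g L.
Hypothesis b_gt0 : 0 < b.
Hypothesis b_le1 : b <= 1.
Hypothesis eta_gt0 : 0 < eta.
Hypothesis tau_gt0 : (0 < tau)%N.
Hypothesis run : gasare_msgd k g b eta tau X M S.

Lemma mask_topk t : is_topk_mask k (g (X (t %/ tau * tau)%N)) (S t).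
Proof.
elim: t => [|t IHt].
  by have [+ _] := run 0%N; rewrite mod0n eqxx div0n mul0n.
have [+ _] := run t.+1; case: ifPn => [/eqP mod0|mod_neq0 ->].
  suff -> : (t.+1 %/ tau * tau = t.+1)%N by [].
  by rewrite [RHS](divn_eq t.+1 tau) mod0 addn0.
suff -> : (t.+1 %/ tau = t %/ tau)%N by [].
by rewrite divnS// /dvdn (negbTE mod_neq0).
Qed.

Lemma mask01 t p : S t p = 0 \/ S t p = 1.
Proof. by have [] := mask_topk t. Qed.

Lemma momentum_masked t p : S t p * M t p = M t p.
Proof.
have [_ [-> _]] := run t; rewrite !ffunE /GRing.scale/=.
by case: (mask01 t p) => ->; rewrite ?mul0r ?mulr0 ?addr0 ?mul1r.
Qed.

Lemma iterate_step t : X t.+1 = X t - eta *: M t.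
Proof.
have [_ [_ ->]] := run t; congr (_ - _ *: _).
by apply/ffunP => p; rewrite ffunE momentum_masked.
Qed.

Let err t : R := sqnorm (M t - hprod (S t) (g (X t))).
(** The index [t %/ tau * tau] is the first step of the block of [t], where its mask was
    selected. *)
Let drift t : R := sqnorm (g (X t) - g (X (t %/ tau * tau)%N)).

Lemma mask_eq t : (t.+1 %% tau != 0)%N -> S t.+1 = S t.
Proof. by move=> h; have [] := run t.+1; rewrite (negbTE h). Qed.

Lemma err_step t :
  err t.+1 <= (1 - b) * err t + b^-1 * sqnorm (g (X t.+1) - g (X t)) +
              (t.+1 %% tau == 0)%N%:R * sqnorm (g (X t.+1)).
Proof.
rewrite /err /sqnorm !mulr_sumr -!big_split/=; apply: ler_sum => p _.
have [_ [-> _]] := run t.+1; rewrite !ffunE /GRing.scale/=.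
apply: momentum_error_coord => //; try exact: mask01; first exact: momentum_masked.
by case: eqP => [|/eqP h]; [left|right; rewrite mask_eq].
Qed.

(** With zero initial momentum the error is [b - 1] times the masked gradient, so step 0 is charged
    like any other fresh mask. *)
Lemma err0 : err 0 <= sqnorm (g (X 0%N)).
Proof.
apply: ler_sum => p _; have [_ [-> _]] := run 0%N; rewrite !ffunE /GRing.scale/=.
have h : (1 - b) ^+ 2 <= 1 by move: b_gt0 b_le1; nra.
have := ler_wpM2r (sqr_ge0 (g (X 0%N) p)) h; have := sqr_ge0 (g (X 0%N) p).
by case: (mask01 0 p) => ->; lra.
Qed.

Lemma grad_step_le t :
  sqnorm (g (X t.+1) - g (X t)) <= L ^+ 2 * eta ^+ 2 * sqnorm (M t).
Proof.
apply: (le_trans (lipschitz_sqnorm _ _ gL _ _)).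
by rewrite iterate_step addrC addrA addNr add0r sqnormN sqnormZ mulrA.
Qed.

Lemma err_sum N :
  b * \sum_(t < N) err t <=
  \sum_(t < N) (t %% tau == 0)%N%:R * sqnorm (g (X t)) +
  b^-1 * (L ^+ 2 * eta ^+ 2) * \sum_(t < N) sqnorm (M t).
Proof.
have bV : 0 <= b^-1 by rewrite invr_ge0 ltW.
case: N => [|N]; first by rewrite !big_ord0 !mulr0 addr0.
(* The last error keeps weight 1 to feed the next contraction; it is lowered to weight [b] only at
   the end. *)
have : b * \sum_(t < N) err t + err N <=
    \sum_(t < N.+1) (t %% tau == 0)%N%:R * sqnorm (g (X t)) +
    b^-1 * (L ^+ 2 * eta ^+ 2) * \sum_(t < N) sqnorm (M t).
  elim: N => [|N IHN].
    rewrite big_ord_recr !big_ord0/= !mulr0 mod0n eqxx mul1r !add0r addr0.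
    exact: err0.
  rewrite big_ord_recr/= [X in _ <= X + _]big_ord_recr/= [X in _ <= _ + _ * X]big_ord_recr/=.
  have := err_step N; have := ler_wpM2l bV (grad_step_le N).
  move: IHN; rewrite !mulrDr !mulrA; lra.
have : b * err N <= err N by rewrite ler_piMl ?sqnorm_ge0.
have : 0 <= b^-1 * (L ^+ 2 * eta ^+ 2) * sqnorm (M N).
  by apply: mulr_ge0; [rewrite mulr_ge0// mulr_ge0 ?sqr_ge0 | exact: sqnorm_ge0].
rewrite [X in _ -> _ -> _ -> b * X <= _]big_ord_recr/= [X in _ -> _ -> _ -> _ <= _ + _ * X]big_ord_recr/=.
rewrite !mulrDr; lra.
Qed.

Lemma iterate_block t j : X (t + j)%N = X t - eta *: \sum_(i < j) M (t + i)%N.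
Proof.
elim: j => [|j IHj]; first by rewrite big_ord0 scaler0 subr0 addn0.
by rewrite addnS iterate_step IHj big_ord_recr scalerDr opprD addrA.
Qed.

(** One factor [tau] comes from Cauchy-Schwarz over at most [tau] steps since the block start, the
    other from the [tau] positions of a block. *)
Lemma drift_sum K :
  \sum_(t < K * tau) drift t <=
  L ^+ 2 * eta ^+ 2 * tau%:R ^+ 2 * \sum_(t < K * tau) sqnorm (M t).
Proof.
rewrite (sum_blocks _ drift) (sum_blocks _ (fun t => sqnorm (M t))) mulr_sumr.
apply: ler_sum => r _; set D := (X in _ <= _ * X).
have D0 : 0 <= D by apply: sumr_ge0 => j _; exact: sqnorm_ge0.
have -> : L ^+ 2 * eta ^+ 2 * tau%:R ^+ 2 * D =
  \sum_(j < tau) L ^+ 2 * (eta ^+ 2 * (tau%:R * D)).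
  by rewrite sumr_const card_ord -mulr_natl; ring.
apply: ler_sum => j _; rewrite /drift divnMDl// divn_small// addn0.
apply: (le_trans (lipschitz_sqnorm _ _ gL _ _)); rewrite ler_wpM2l ?sqr_ge0//.
rewrite iterate_block addrC addrA addNr add0r sqnormN sqnormZ ler_wpM2l ?sqr_ge0//.
apply: (le_trans (sqnorm_sum_le (fun i => M (r * tau + i)%N) j)).
apply: ler_pM => //; first by apply: sumr_ge0 => i _; exact: sqnorm_ge0.
  by rewrite ler_nat ltnW.
apply: (ler_sum_prefix _ (fun i => sqnorm (M (r * tau + i)%N))).
  by move=> i; exact: sqnorm_ge0.
by rewrite ltnW.
Qed.

(** All positions of a block share its start. Spreading the once-per-block terms over all steps
    gains the factor [tau] that pays for mask changes. *)
Lemma block_start_sum K :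
  tau%:R * \sum_(t < K * tau) (t %% tau == 0)%N%:R * sqnorm (g (X t)) =
  \sum_(t < K * tau) sqnorm (g (X (t %/ tau * tau)%N)).
Proof.
rewrite (sum_blocks _ (fun t => (t %% tau == 0)%N%:R * sqnorm (g (X t)))).
rewrite (sum_blocks _ (fun t => sqnorm (g (X (t %/ tau * tau)%N)))) mulr_sumr.
apply: eq_bigr => r _.
rewrite (bigD1 (Ordinal tau_gt0))//= addn0 modnMl eqxx mul1r big1 => [|j j0].
  rewrite addr0 (eq_bigr (fun=> sqnorm (g (X (r * tau)%N)))) => [|j _].
    by rewrite sumr_const card_ord mulr_natl.
  by rewrite divnMDl// divn_small// addn0.
by rewrite modnMDl modn_small// (negbTE (_ : j != 0 :> nat)) ?mul0r.
Qed.

Lemma start_le t : sqnorm (g (X (t %/ tau * tau)%N)) <=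
  2 * sqnorm (g (X t)) + 2 * drift t.
Proof.
apply: (le_trans (sqnormB_le2 _ (g (X t)))); rewrite lerD2l ler_wpM2l//.
by rewrite -sqnormN opprB.
Qed.

(** With [y] the gradient at the block start, the chain is |g|^2 to |y|^2, then [topk_sqnorm], then
    |S y|^2 back to |S g|^2. Each passage costs a factor 2 and a drift; [delta <= 1] gives 4 + 2 = 6
    drifts. *)
Lemma mask_energy t :
  delta * sqnorm (g (X t)) <= 4 * sqnorm (hprod (S t) (g (X t))) + 6 * drift t.
Proof.
have d0 := delta_min_gt0 (R := R) k k_bounds; have d1 : delta <= 1 := delta_min_le1 k.
set y := g (X (t %/ tau * tau)%N).
have h0 : 0 <= drift t by exact: sqnorm_ge0.
have h1 : delta * sqnorm y <= sqnorm (hprod (S t) y).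
  exact: topk_sqnorm (mask_topk t).
have h2 : sqnorm (g (X t)) <= 2 * sqnorm y + 2 * drift t by exact: sqnormB_le2.
have h3 : sqnorm (hprod (S t) y) <=
    2 * sqnorm (hprod (S t) (g (X t))) + 2 * drift t.
  rewrite /drift !mulr_sumr -big_split/=; apply: ler_sum => p _; rewrite !ffunE -/y.
  have := sqr_ge0 (2 * g (X t) p - y p); have := sqr_ge0 (g (X t) p - y p).
  by case: (mask01 t p) => ->; lra.
nra.
Qed.

Lemma descent_step t : eta * L <= 1 / 4 ->
  f (X t.+1) <= f (X t) - eta / 2 * sqnorm (hprod (S t) (g (X t)))
                - 3 * eta / 8 * sqnorm (M t) + eta / 2 * err t.
Proof.
move=> etaL; have := descent_lemma _ _ _ fg L_gt0 gL (X t) (- (eta *: M t)).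
rewrite -iterate_step sqnormN sqnormZ.
(* Polarization: on the support of [M t] the gradient equals its masked version. *)
have -> : inner (g (X t)) (- (eta *: M t)) =
    eta / 2 * err t - eta / 2 * sqnorm (hprod (S t) (g (X t))) - eta / 2 * sqnorm (M t).
  rewrite /err !mulr_sumr -!sumrB; apply: eq_bigr => p _.
  rewrite !ffunE /GRing.scale/=.
  have := momentum_masked t p; case: (mask01 t p) => -> h; last by field.
  by rewrite -h; field.
(* The quadratic term is at most [eta / 8 * sqnorm (M t)], which turns the coefficient 1/2 into
   3/8. *)
have := ler_wpM2l (mulr_ge0 (ltW eta_gt0) (sqnorm_ge0 (M t))) etaL.
move: (sqnorm (M t)) => D; nra.
Qed.

Lemma descent_sum N : eta * L <= 1 / 4 ->
  eta / 2 * \sum_(t < N) sqnorm (hprod (S t) (g (X t))) +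
  3 * eta / 8 * \sum_(t < N) sqnorm (M t) <=
  f (X 0%N) - f (X N) + eta / 2 * \sum_(t < N) err t.
Proof.
move=> etaL; elim: N => [|N IHN]; first by rewrite !big_ord0 !mulr0 !addr0 subrr.
rewrite !big_ord_recr/=; have := descent_step N etaL; move: IHN; rewrite !mulrDr; lra.
Qed.

(** The step-size conditions are polynomial, so that the bounds in (i) and the explicit choice in
    (ii) both reduce to them. *)
Theorem gradient_sum_le K :
  64 <= 3 * b * delta * tau%:R -> eta * L <= 1 / 4 ->
  80 * L ^+ 2 * eta ^+ 2 <= 3 * delta * b ^+ 2 ->
  80 * tau%:R ^+ 2 * L ^+ 2 * eta ^+ 2 <= 3 * delta ->
  delta * eta * \sum_(t < K * tau) sqnorm (g (X t)) <= 16 * Delta f (X 0%N).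
Proof.
move=> tau_ge etaL eta_b eta_tau.
have d0 := delta_min_gt0 (R := R) k k_bounds; have d1 : delta <= 1 := delta_min_le1 k.
have := descent_sum (K * tau) etaL.
have : f (X 0%N) - f (X (K * tau)%N) <= Delta f (X 0%N).
  by rewrite lerD2l lerN2; apply: ge_inf => //; exists (X (K * tau)%N).
have := err_sum (K * tau); have := drift_sum K; have := block_start_sum K.
have : \sum_(t < K * tau) sqnorm (g (X (t %/ tau * tau)%N)) <=
    2 * \sum_(t < K * tau) sqnorm (g (X t)) + 2 * \sum_(t < K * tau) drift t.
  by rewrite !mulr_sumr -big_split; apply: ler_sum => t _; exact: start_le.
have : delta * \sum_(t < K * tau) sqnorm (g (X t)) <=
    4 * \sum_(t < K * tau) sqnorm (hprod (S t) (g (X t))) + 6 * \sum_(t < K * tau) drift t.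
  by rewrite !mulr_sumr -big_split; apply: ler_sum => t _; exact: mask_energy.
have : 0 <= \sum_(t < K * tau) drift t by apply: sumr_ge0 => t _; exact: sqnorm_ge0.
have : 0 <= \sum_(t < K * tau) sqnorm (M t) by apply: sumr_ge0 => t _; exact: sqnorm_ge0.
have : 0 <= \sum_(t < K * tau) (t %% tau == 0)%N%:R * sqnorm (g (X t)).
  by apply: sumr_ge0 => t _; rewrite mulr_ge0// sqnorm_ge0.
have : 0 <= \sum_(t < K * tau) sqnorm (g (X t)) by apply: sumr_ge0 => t _; exact: sqnorm_ge0.
(* Only inequalities between numbers remain. The sums are [A] of gradients, [J] of gradients at
   fresh masks, [D] of momenta, [Q] of drifts, [H] of masked gradients, [B] of block-start gradients
   and [E] of errors. *)
move: (\sum_(t < _) sqnorm (g (X t))) (\sum_(t < _) _ * sqnorm (g (X t)))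
  (\sum_(t < _) sqnorm (M t)) (\sum_(t < _) drift t)
  (\sum_(t < _) sqnorm (hprod (S t) (g (X t))))
  (\sum_(t < _) sqnorm (g (X (t %/ tau * tau)%N)))
  (\sum_(t < _) err t) (f _ - f _) (Delta f _).
move=> A J D Q H B E F Dl A0 J0 D0 Q0 hA hB hJ hQ hE hF hD.
have hJB : 64 * J <= 3 * b * delta * B.
  by rewrite -hJ mulrA; exact: ler_wpM2r.
have hE' : 64 * E <= 3 * delta * B + 12 / 5 * delta * D.
  rewrite -(ler_pM2l b_gt0).
  have : b^-1 * (L ^+ 2 * eta ^+ 2) * D <= 3 / 80 * b * delta * D.
    apply: ler_wpM2r => //; rewrite mulrC ler_pdivrMr//; nra.
  nra.
have hQ' : 80 * Q <= 3 * D.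
  have h : 80 * (L ^+ 2 * eta ^+ 2 * tau%:R ^+ 2) <= 3 by move: eta_tau d1; lra.
  by have := ler_wpM2r D0 h; move: hQ; lra.
have hdB : delta * B <= 2 * (delta * A) + 2 * Q.
  have := ler_wpM2l (ltW d0) hB; have := ler_wpM2r Q0 d1; lra.
have hdD : delta * D <= D by rewrite ler_piMl.
(* Double [hA] and spend 3/4 of one copy of [delta * A] on [8 * E]; the leftover multiples of [Q]
   and [D] fit into [6 * D]. Times [eta], the right side is 16 times the combination bounded by
   [hD]. *)
have hA' : delta * A <= 8 * H + 6 * D - 8 * E.
  by have := mulr_ge0 (ltW d0) A0; lra.
have := ler_wpM2l (ltW eta_gt0) hA'; move: hF hD; lra.
Qed.

End Gasare.

(** * Step-size arithmetic and the two final bounds *)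

Lemma le_sqrt_mul (R : rcfType) (x y c d : R) :
  0 <= x -> 0 <= c -> 0 < d -> x <= Num.sqrt (c / d) -> d * x ^+ 2 <= c.
Proof.
move=> x0 c0 d0 xle; rewrite mulrC -ler_pdivlMr//.
rewrite -(sqr_sqrtr (divr_ge0 c0 (ltW d0))).
by rewrite lerXn2r ?nnegrE// sqrtr_ge0.
Qed.

Lemma sqrt_mul_le (R : rcfType) (c u w : R) :
  0 <= w -> c * u ^+ 2 <= w ^+ 2 -> Num.sqrt c * u <= w.
Proof.
move=> w0 cuw; have [c0|c0] := leP c 0; first by rewrite ler0_sqrtr// mul0r.
have [u0|u0] := leP u 0; first by rewrite (le_trans _ w0)// mulr_ge0_le0 ?sqrtr_ge0.
by rewrite -ler_sqr ?nnegrE ?mulr_ge0 ?sqrtr_ge0 ?(ltW u0)// exprMn sqr_sqrtr ?(ltW c0).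
Qed.

Theorem theoremC4 (R : realType) :
  (* (i) *)
  (forall (NL : nat) (m n k : 'I_NL -> nat) (f : pvec R m n -> R)
     (g : pvec R m n -> pvec R m n) (L beta1 eta : R) (tau : nat)
     (X M S : nat -> pvec R m n),
     (0 < NL)%N ->
     (forall l, 0 < k l < m l * n l)%N ->
     is_gradient f g ->
     has_lbound (range f) ->
     0 < L -> lipschitz_grad g L ->
     0 < beta1 -> beta1 <= 1 ->
     64 / (3 * beta1 * delta_min m n k R) <= tau%:R ->
     0 < eta ->
     eta <= 1 / (4 * L) ->
     eta <= Num.sqrt (3 * delta_min m n k R * beta1 ^+ 2 / (80 * L ^+ 2)) ->
     eta <= Num.sqrt (3 * delta_min m n k R / (80 * tau%:R ^+ 2 * L ^+ 2)) ->
     eta <= Num.sqrt (3 * beta1 / (16 * tau%:R * L ^+ 2)) ->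
     gasare_msgd k g beta1 eta tau X M S ->
     forall K : nat, (1 <= K)%N ->
       (K * tau)%:R^-1 * \sum_(t < K * tau) sqnorm (g (X t))
       <= 16 * Delta f (X 0%N) / (delta_min m n k R * eta * (K * tau)%:R))
  /\
  (* (ii) *)
  (exists C : R,
   forall (NL : nat) (m n k : 'I_NL -> nat) (f : pvec R m n -> R)
     (g : pvec R m n -> pvec R m n) (L beta1 eta : R) (tau T : nat)
     (X M S : nat -> pvec R m n),
     (0 < NL)%N ->
     (forall l, 0 < k l < m l * n l)%N ->
     is_gradient f g ->
     has_lbound (range f) ->
     0 < L -> lipschitz_grad g L ->
     0 < Delta f (X 0%N) ->
     64 / (3 * delta_min m n k R) <= T%:R ->
     beta1 = 1 ->
     (tau%:R : R) = (Num.ceil (64 / (3 * delta_min m n k R * beta1)))%:~R ->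
     eta = (4 * L
            + Num.sqrt (80 * L ^+ 2 / (3 * delta_min m n k R * beta1 ^+ 2))
            + Num.sqrt (80 * tau%:R ^+ 2 * L ^+ 2 / (3 * delta_min m n k R))
            + Num.sqrt (16 * tau%:R * L ^+ 2 / (3 * beta1)))^-1 ->
     gasare_msgd k g beta1 eta tau X M S ->
       T%:R^-1 * \sum_(t < T) sqnorm (g (X t))
       <= C * (L * Delta f (X 0%N))
              / (delta_min m n k R ^+ 2 * Num.sqrt (delta_min m n k R) * T%:R)).
Proof.
split.
  move=> NL m n k f g L b eta tau X M S NL0 k_bounds fg f_lb L0 gL b0 b1 tau_ge
    eta0 eta1 eta2 eta3 _ run K K1.
  have d0 := delta_min_gt0 (R := R) k k_bounds.
  have bd0 : 0 < 3 * b * delta_min m n k R by rewrite !mulr_gt0.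
  have tauE : 64 <= 3 * b * delta_min m n k R * tau%:R.
    by rewrite mulrC -ler_pdivrMr.
  have tau0 : (0 < tau)%N.
    by case: tau tauE {tau_ge eta3 run} => //; rewrite mulr0; lra.
  have tauR : 0 < tau%:R :> R by rewrite ltr0n.
  have etaL : eta * L <= 1 / 4.
    by move: eta1; rewrite ler_pdivlMr ?mulr_gt0//; lra.
  have L2 : 0 < L ^+ 2 by rewrite exprn_gt0.
  have eta_b : 80 * L ^+ 2 * eta ^+ 2 <= 3 * delta_min m n k R * b ^+ 2.
    by apply: le_sqrt_mul => //; rewrite ?mulr_gt0 ?mulr_ge0 ?exprn_ge0// ltW.
  have eta_tau : 80 * tau%:R ^+ 2 * L ^+ 2 * eta ^+ 2 <= 3 * delta_min m n k R.
    by apply: le_sqrt_mul => //; rewrite ?mulr_gt0 ?exprn_gt0// ltW// mulr_gt0.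
  have KT0 : 0 < (K * tau)%:R :> R by rewrite ltr0n muln_gt0 K1.
  rewrite ler_pdivlMr ?mulr_gt0// [leLHS](_ : _ =
    delta_min m n k R * eta * \sum_(t < K * tau) sqnorm (g (X t))); last first.
    by field; rewrite !pnatr_eq0 -!lt0n tau0 K1.
  exact: (gradient_sum_le k_bounds fg f_lb L0 gL b0 b1 eta0 tau0 run).
(* The constant is 16 * 160: 16 from [gradient_sum_le] and 160 from [wdu] below. *)
exists 2560 => NL m n k f g L b eta tau T X M S NL0 k_bounds fg f_lb L0 gL Delta0
  T_ge b1 tauE etaE run.
have d0 := delta_min_gt0 (R := R) k k_bounds.
have d1 : delta_min m n k R <= 1 := delta_min_le1 k.
have := gradient_sum_le (tau := tau) k_bounds fg f_lb L0 gL _ _ _ _ run.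
move: d0 d1 T_ge tauE etaE Delta0; rewrite b1 !mulr1 expr1n mulr1 => {b b1 run}.
set d := delta_min m n k R; set u := Num.sqrt d.
set a2 := Num.sqrt _; set a3 := Num.sqrt _; set a4 := Num.sqrt _.
move=> d0 d1 T_ge tauE etaE Delta0 bound.
have u0 : 0 < u by rewrite sqrtr_gt0.
have u2 : u ^+ 2 = d by rewrite sqr_sqrtr// ltW.
have u1 : u <= 1 by rewrite -(@ler_pXn2r _ 2)// ?nnegrE ?(ltW u0)// u2 expr1n.
have y0 : 0 < 64 / (3 * d) by rewrite divr_gt0// mulr_gt0.
have /andP[] := ceil_itv (64 / (3 * d)); rewrite rmorphB/= -tauE => /ltW + tau_ge.
rewrite lerBlDr => tau_le.
have tauR0 : 0 < tau%:R :> R by exact: lt_le_trans tau_ge.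
have tau0 : (0 < tau)%N by rewrite -(ltr0n R).
have tau_d1 : 64 <= 3 * d * tau%:R by rewrite mulrC -ler_pdivrMr// mulr_gt0.
(* Rounding up adds at most 1 to [tau], and 64/3 + 1 < 23. *)
have tau_d2 : tau%:R * d <= 23.
  have := ler_wpM2r (ltW d0) tau_le.
  have -> : (64 / (3 * d) + 1) * d = 64 / 3 + d by field; rewrite gt_eqF.
  lra.
have T0 : 0 < T%:R :> R by exact: lt_le_trans T_ge.
have a20 : 0 <= a2 by exact: sqrtr_ge0.
have a30 : 0 <= a3 by exact: sqrtr_ge0.
have a40 : 0 <= a4 by exact: sqrtr_ge0.
set w := (X in X^-1) in etaE.
have w0 : 0 < w by rewrite /w; lra.
have eta0 : 0 < eta by rewrite etaE invr_gt0.
have etaw : eta * w = 1 by rewrite etaE mulVf// gt_eqF.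
(* Each summand of [w], the inverse of [eta], yields one step-size condition. *)
have part (c : R) : 0 <= c -> c <= w -> eta * c <= 1.
  by move=> c0 cw; rewrite -etaw ler_wpM2l// ltW.
have d3 : 0 < 3 * d by rewrite mulr_gt0.
have L20 : 0 < L ^+ 2 by rewrite exprn_gt0.
have sqr_part (c : R) : 0 <= c -> Num.sqrt c <= w -> c * eta ^+ 2 <= 1.
  move=> c0 cw; rewrite -(sqr_sqrtr c0) -exprMn mulrC expr_le1//.
    by apply: part => //; exact: sqrtr_ge0.
  by rewrite mulr_ge0 ?sqrtr_ge0// ltW.
have etaL : eta * L <= 1 / 4.
  have : eta * (4 * L) <= 1 by apply: part; rewrite /w; lra.
  lra.
have eta_b : 80 * L ^+ 2 * eta ^+ 2 <= 3 * d.
  have : 80 * L ^+ 2 / (3 * d) * eta ^+ 2 <= 1.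
    apply: sqr_part; last by rewrite -/a2 /w; lra.
    by rewrite divr_ge0// ltW// mulr_gt0.
  by rewrite [leLHS]mulrAC ler_pdivrMr// mul1r.
have eta_tau : 80 * tau%:R ^+ 2 * L ^+ 2 * eta ^+ 2 <= 3 * d.
  have : 80 * tau%:R ^+ 2 * L ^+ 2 / (3 * d) * eta ^+ 2 <= 1.
    apply: sqr_part; last by rewrite -/a3 /w; lra.
    by rewrite divr_ge0// ltW// !mulr_gt0// exprn_gt0.
  by rewrite [leLHS]mulrAC ler_pdivrMr// mul1r.
have a2u : a2 * u <= 6 * L.
  apply: sqrt_mul_le; first by rewrite mulr_ge0// ltW.
  rewrite u2 [leLHS](_ : _ = 80 / 3 * L ^+ 2); last by field; rewrite gt_eqF.
  by rewrite exprMn; lra.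
have a3u : a3 * u <= 6 * tau%:R * L.
  apply: sqrt_mul_le; first by rewrite !mulr_ge0// ltW.
  rewrite u2 [leLHS](_ : _ = 80 / 3 * (tau%:R * L) ^+ 2); last by field; rewrite gt_eqF.
  by have := sqr_ge0 (tau%:R * L); lra.
have a4u : a4 * u <= 12 * L.
  apply: sqrt_mul_le; first by rewrite mulr_ge0// ltW.
  rewrite u2 [leLHS](_ : _ = 16 / 3 * (tau%:R * d) * L ^+ 2); last by field.
  have := ler_wpM2r (ltW L20) tau_d2; lra.
(* The product [d * u] is the power 3/2 of [d]. The four summands of [w] contribute 4, 6, 6 * 23 =
   138 and 12. *)
have wdu : w * (d * u) <= 160 * L.
  have du1 : d * u <= 1 by rewrite mulr_ile1// ltW.
  have h1 := ler_wpM2l (ltW L0) du1.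
  have h2 := ler_wpM2l (ltW d0) a2u.
  have h3 := ler_wpM2l (ltW d0) a3u.
  have h4 := ler_wpM2l (ltW d0) a4u.
  have h5 := ler_wpM2l (ltW L0) d1.
  have h6 := ler_wpM2l (ltW L0) tau_d2.
  by rewrite /w; lra.
(* [T] need not be a multiple of [tau]. Completing the last block is free, since the bound on the
   sum does not depend on the number of blocks. *)
have sum_le : \sum_(t < T) sqnorm (g (X t)) <=
    \sum_(t < (T %/ tau).+1 * tau) sqnorm (g (X t)).
  apply: (ler_sum_prefix _ (fun t => sqnorm (g (X t)))).
    by move=> t; exact: sqnorm_ge0.
  by rewrite ltnW// ltn_ceil.
have {}bound := bound ltr01 (lexx 1) eta0 tau0 (T %/ tau).+1 tau_d1 etaL eta_b eta_tau.
rewrite ler_pdivlMr; last by rewrite !mulr_gt0// exprn_gt0.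
rewrite [leLHS](_ : _ = d * (d * u) * \sum_(t < T) sqnorm (g (X t))); last first.
  by field; rewrite gt_eqF.
have du0 : 0 <= d * u by rewrite mulr_ge0// ltW.
apply: (@le_trans _ _ ((w * (d * u)) * (16 * Delta f (X 0%N)))); last first.
  have D16 : 0 <= 16 * Delta f (X 0%N) by lra.
  by have := ler_wpM2r D16 wdu; lra.
have wdu0 : 0 <= w * (d * u) by rewrite mulr_ge0// ltW.
apply: le_trans (ler_wpM2l wdu0 bound).
rewrite [leRHS](_ : _ = (eta * w) * (d * (d * u)) *
  \sum_(t < (T %/ tau).+1 * tau) sqnorm (g (X t))); last by ring.
by rewrite etaw mul1r ler_wpM2l// mulr_ge0// ltW.
Qed.
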